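(* Let $[\epsilon_{ij}]_{1\le i,j\le m}$ be a symmetric matrix with zero diagonal and positive off-diagonal entries, let $p_i>0$, $1\le i\le m$, and consider the optimization problem $$\varepsilon_*=\min_{\alpha=[\alpha_{ij}]\in\mathbb R^{m\times m}}\Big\{f(\alpha):=\max_{1\le i\le m}\sum_{j=1}^m p_i\epsilon_{ij}\exp\{\alpha_{ij}\}\ :\ \alpha=-\alpha^T\Big\}.$$ Let $\rho$ be the Perron--Frobenius eigenvalue of the entrywise nonnegative matrix $\bar E=[p_i\epsilon_{ij}]_{1\le i,j\le m}$. Then the corresponding eigenvector $g\in\mathbb R^m$ can be selected to be (entrywise) positive, and for the choice $\bar\alpha_{ij}:=\ln(g_j)-\ln(g_i)$, $1\le i,j\le m$, one has $$\varepsilon_*=f(\bar\alpha)=\rho.$$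
   Context: The Perron--Frobenius eigenvalue of an entrywise nonnegative square matrix is its largest in magnitude eigenvalue (its spectral radius), which is a nonnegative real eigenvalue. *)

(* Defs.v *)
From mathcomp Require Import all_boot all_order all_algebra.
From mathcomp Require Import all_classical all_reals all_analysis.
From mathcomp Require Import complex.

Set Implicit Arguments.
Unset Strict Implicit.
Unset Printing Implicit Defensive.

Import Order.TTheory GRing.Theory Num.Theory.

Local Open Scope classical_set_scope.
Local Open Scope ring_scope.
Local Open Scope complex_scope.

(* The spectral radius ranges over complex eigenvalues, hence the embedding of
   the real matrix into R[i]. (MathComp's [eigenvalue] refers to row
   eigenvectors; for a square matrix the spectrum is the same.) *)
Definition spectral_radius (R : realType) (n : nat) (A : 'M[R]_n) : R :=
  sup [set r : R | exists2 z : R[i],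
         eigenvalue (map_mx (real_complex R) A) z & `|z| = r%:C].

Definition skew_mx (R : realType) (n : nat) : set 'M[R]_n :=
  [set alpha | alpha = - alpha^T].

Definition weighted_mx (R : realType) (n : nat) (p : 'I_n -> R)
    (eps : 'M[R]_n) : 'M[R]_n :=
  \matrix_(i, j) (p i * eps i j).

Definition objective_row (R : realType) (n : nat) (p : 'I_n -> R)
    (eps alpha : 'M[R]_n) (i : 'I_n) : R :=
  \sum_(j < n) p i * eps i j * expR (alpha i j).

(* The size is a successor so that the maximum over rows is a genuine maximum:
   its starting value is one of the rows. *)
Definition objective (R : realType) (n : nat) (p : 'I_n.+1 -> R)
    (eps alpha : 'M[R]_n.+1) : R :=
  \big[Num.max/objective_row p eps alpha ord0]_(i < n.+1)
    objective_row p eps alpha i.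

Definition is_minimum (R : realType) (S : set R) (v : R) : Prop :=
  S v /\ lbound S v.

Definition log_ratio_mx (R : realType) (n : nat) (g : 'cV[R]_n) : 'M[R]_n :=
  \matrix_(i, j) (ln (g j ord0) - ln (g i ord0)).

(* Main.v *)
Require Import Defs.
From mathcomp Require Import all_boot all_order all_algebra.
From mathcomp Require Import all_classical all_reals all_analysis.
From mathcomp Require Import complex ring lra.

Set Implicit Arguments.
Unset Strict Implicit.
Unset Printing Implicit Defensive.

Import Order.TTheory GRing.Theory Num.Theory.
Import numFieldNormedType.Exports.

Local Open Scope classical_set_scope.
Local Open Scope ring_scope.

(** Write [E] for the matrix with entries [p i * eps i j].

    Existence of [g].  The matrix [E] is self-adjoint for the scalar product
    with weights [1 / p i], so a Perron vector can be found variationally: let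
    [lam] be the maximum of the Rayleigh quotient of [eps] relative to the
    diagonal form [diag (1 / p i)] ([max_rayleigh_quotient]).  Replacing a
    maximizer [x] by its entrywise absolute value does not decrease the
    quotient, since [eps] is nonnegative.  At a maximizer the positive
    semidefinite form [lam * diag (1 / p i) - eps] vanishes, hence so does its
    product with the vector ([psd_isotropic_kernel]), which says exactly that
    the vector is a [lam]-eigenvector of [E].  A zero entry would force all
    other entries to vanish, because the off-diagonal entries are positive
    ([weighted_mx_perron_vector]).

    Identification of the eigenvalue.  A positive eigenvector [g] bounds every
    complex eigenvalue: pairing the entrywise modulus of a row eigenvector with
    [g] gives [|z| <= lam].  The row vector [g i / p i] is a left eigenvector,
    so the bound is attained ([spectral_radius_perron]).

    Optimality.  At the log-ratio matrix of [g] every row of the objective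
    equals [(E g) i / g i = lam].  For an arbitrary skew-symmetric [alpha], the
    maximum over rows is at least the average with weights [g i ^+ 2 / p i];
    in that average the terms [(i, j)] and [(j, i)] carry the same coefficient
    [eps i j] and reciprocal exponentials, and the inequality between
    arithmetic and geometric means bounds their sum below by
    [2 * eps i j * g i * g j].  Summing gives [lam] again
    ([objective_skew_lower_bound]).  These weights are the ones for which the
    bound is tight at the log-ratio matrix. *)

(** * Quadratic forms and the Rayleigh quotient *)

Definition quad_form (R : pzRingType) (n : nat) (B : 'M[R]_n) (x : 'rV[R]_n) : R :=
  (x *m B *m x^T) ord0 ord0.

Lemma quad_formE (R : pzRingType) (n : nat) (B : 'M[R]_n) (x : 'rV[R]_n) :
  quad_form B x = \sum_j \sum_i x ord0 i * B i j * x ord0 j.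
Proof.
rewrite /quad_form mxE; apply: eq_bigr => j _.
by rewrite !mxE mulr_suml.
Qed.

Lemma quad_formZ (R : comPzRingType) (n : nat) (B : 'M[R]_n) (a : R)
    (x : 'rV[R]_n) : quad_form B (a *: x) = a ^+ 2 * quad_form B x.
Proof. by rewrite /quad_form linearZ /= -!scalemxAl -scalemxAr scalerA mxE expr2. Qed.

Lemma quad_formB (R : pzRingType) (n : nat) (B C : 'M[R]_n) (x : 'rV[R]_n) :
  quad_form (B - C) x = quad_form B x - quad_form C x.
Proof. by rewrite /quad_form mulmxBr mulmxBl !mxE. Qed.

Lemma quad_formZl (R : comPzRingType) (n : nat) (a : R) (B : 'M[R]_n)
    (x : 'rV[R]_n) : quad_form (a *: B) x = a * quad_form B x.
Proof. by rewrite /quad_form -scalemxAr -scalemxAl mxE. Qed.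

Lemma quad_form_diag (R : comPzRingType) (n : nat) (w x : 'rV[R]_n) :
  quad_form (diag_mx w) x = \sum_i w ord0 i * x ord0 i ^+ 2.
Proof.
rewrite /quad_form mul_mx_diag mxE; apply: eq_bigr => i _; rewrite !mxE.
by ring.
Qed.

Lemma quad_form_continuous (R : realType) (n : nat) (B : 'M[R]_n) :
  continuous (quad_form B : 'rV[R]_n -> R).
Proof.
rewrite (_ : quad_form B =
  fun x : 'rV[R]_n => \sum_j \sum_i x ord0 i * B i j * x ord0 j); last first.
  by apply/funext => y; rewrite quad_formE.
apply: continuous_big => [|j _]; first exact: add_continuous.
apply: continuous_big => [|i _ x]; first exact: add_continuous.
have coord k : y ord0 k @[y --> x] --> x ord0 k by exact: coord_continuous.
exact: (cvgM (cvgM (coord i) (cvg_cst (B i j))) (coord j)).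
Qed.

(** The quotient is homogeneous of degree zero, so it is enough to maximize it
    on the unit sphere of the matrix (sup) norm, which is compact and on which
    the denominator does not vanish. *)
Lemma max_rayleigh_quotient (R : realType) (n : nat) (A W : 'M[R]_n.+1) :
    (forall x, x != 0 -> 0 < quad_form W x) ->
  exists lam : R, exists x : 'rV[R]_n.+1,
    [/\ x != 0, quad_form A x = lam * quad_form W x &
        forall y, quad_form A y <= lam * quad_form W y].
Proof.
move=> W_pos.
pose S : set 'rV[R]_n.+1 := [set x | `|x| = 1].
pose q x := quad_form A x / quad_form W x.
have norm_unit (y : 'rV[R]_n.+1) : y != 0 -> S (`|y|^-1 *: y).
  move=> y0; rewrite /S /= normrZ ger0_norm ?invr_ge0 ?normr_ge0 //.
  by rewrite mulVf // normr_eq0.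
have S_neq0 x : S x -> x != 0.
  by move=> Sx; rewrite -normr_eq0 Sx oner_eq0.
have S_nonempty : S !=set0.
  exists (`|const_mx 1 : 'rV[R]_n.+1|^-1 *: const_mx 1); apply: norm_unit.
  by apply/eqP => /matrixP/(_ ord0 ord0); rewrite !mxE => /eqP; rewrite oner_eq0.
have S_compact : compact S.
  apply: bounded_closed_compact.
    exists 1; split; first exact: real1.
    by move=> M M1 x /= ->; exact: ltW.
  apply: (@closed_comp _ _ (fun x : 'rV[R]_n.+1 => `|x|) [set 1]).
    by move=> x _; exact: norm_continuous.
  exact: closed_eq.
have q_cont : {within S, continuous q}.
  apply: continuous_in_subspaceT => x /set_mem/S_neq0 x0.
  have cont B : quad_form B y @[y --> x] --> quad_form B x.
    exact: quad_form_continuous.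
  by apply: (cvgM (cont A)); apply: (cvgV _ (cont W)); rewrite gt_eqF ?W_pos.
have [x /set_mem Sx x_max] := EVT_max_rV S_nonempty S_compact q_cont.
have x0 := S_neq0 _ Sx.
exists (q x), x; split=> //.
  by rewrite /q divfK // gt_eqF // W_pos.
move=> y; have [->|y0] := eqVneq y 0.
  by rewrite -(scale0r (0 : 'rV[R]_n.+1)) !quad_formZ expr0n /= !mul0r mulr0.
have /x_max : (`|y|^-1 *: y) \in S by apply/mem_set/norm_unit.
have y'0 : `|y|^-1 != 0 by rewrite invr_eq0 normr_eq0.
rewrite {1}/q !quad_formZ -mulf_div divff ?mul1r ?sqrf_eq0 //.
by rewrite ler_pdivrMr // W_pos.
Qed.

(** First-order optimality: [x] minimizes the form, so moving from [x] in the
    direction [x *m B] cannot change its value to first order; but that first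
    order term is twice the sum of the squares of the entries of [x *m B]. *)
Lemma psd_isotropic_kernel (R : realFieldType) (n : nat) (B : 'M[R]_n)
    (x : 'rV[R]_n) :
    B^T = B -> (forall y, 0 <= quad_form B y) -> quad_form B x = 0 ->
  x *m B = 0.
Proof.
move=> B_sym B_psd x_iso; pose d := x *m B; pose b := (d *m d^T) ord0 ord0.
have expand t : quad_form B (x + t *: d) = 2 * t * b + t ^+ 2 * quad_form B d.
  have dx : d *m B *m x^T = d *m d^T by rewrite trmx_mul B_sym mulmxA.
  have xd : x *m B *m d^T = d *m d^T by [].
  rewrite -quad_formZ /quad_form linearD /= !mulmxDl !mulmxDr.
  rewrite [(t *: d)^T]linearZ /=.
  rewrite mxE [X in X + _ = _]mxE [X in _ + X = _]mxE -/(quad_form B x) x_iso.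
  rewrite -[t *: d *m B]scalemxAl -[t *: (d *m B) *m x^T]scalemxAl dx.
  rewrite -[x *m B *m _]scalemxAr xd mxE -/b.
  by ring.
have bE : b = \sum_i d ord0 i ^+ 2.
  by rewrite /b mxE; apply: eq_bigr => i _; rewrite [d^T _ _]mxE expr2.
have b0 : b = 0.
  have c0 := B_psd d; set c := quad_form B d in c0 expand.
  (* The step [- b / c] would be the optimal one; the shift by [1] avoids
     a division by zero when [c = 0] and still makes the value negative
     unless [b = 0]. *)
  have := B_psd (x + (- b / (c + 1)) *: d); rewrite expand.
  have c1 : 0 < c + 1 by lra.
  rewrite (_ : _ + _ = - (b ^+ 2 * (c + 2) / (c + 1) ^+ 2)); last first.
    by field; rewrite gt_eqF.
  rewrite oppr_ge0 pmulr_lle0 ?invr_gt0 ?exprn_gt0 // pmulr_lle0 ; last lra.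
  by move=> b_le0; apply/eqP; rewrite -sqrf_eq0 eq_le b_le0 sqr_ge0.
apply/rowP => i; rewrite -/d [RHS]mxE; apply/eqP; rewrite -sqrf_eq0.
move: b0; rewrite bE => /eqP; rewrite psumr_eq0; last by move=> j _; exact: sqr_ge0.
by move=> /allP /(_ i (mem_index_enum _)).
Qed.

(** * Perron-Frobenius theory for a symmetric matrix with rescaled rows *)

(** The eigenvector is the entrywise absolute value of a maximizer of the
    Rayleigh quotient of [eps] relative to [diag (1 / p i)]; the equation
    [y *m eps = lam *: y *m diag (1 / p i)] is the eigenvalue equation of
    [weighted_mx p eps] once its [i]-th entry is multiplied by [p i]. *)
Lemma weighted_mx_perron_vector (R : realType) (n : nat) (p : 'I_n.+1 -> R)
    (eps : 'M[R]_n.+1) :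
    eps^T = eps -> (forall i, 0 <= eps i i) ->
    (forall i j, i != j -> 0 < eps i j) -> (forall i, 0 < p i) ->
  exists lam : R, exists2 g : 'cV[R]_n.+1,
    forall i, 0 < g i ord0 & weighted_mx p eps *m g = lam *: g.
Proof.
move=> eps_sym eps_diag eps_off p_pos.
have eps_ge0 i j : 0 <= eps i j.
  by have [->|/eps_off/ltW] := eqVneq i j.
pose W : 'M[R]_n.+1 := diag_mx (\row_i (p i)^-1).
have WE x : quad_form W x = \sum_i (p i)^-1 * x ord0 i ^+ 2.
  by rewrite quad_form_diag; apply: eq_bigr => i _; rewrite mxE.
have term_ge0 (x : 'rV[R]_n.+1) i : 0 <= (p i)^-1 * x ord0 i ^+ 2.
  by rewrite mulr_ge0 ?sqr_ge0 // invr_ge0 ltW.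
have W_pos x : x != 0 -> 0 < quad_form W x.
  move=> /rV0Pn [i xi]; rewrite WE (bigD1 i) //= ltr_pwDl //.
    by rewrite mulr_gt0 ?invr_gt0 // exprn_even_gt0.
  by apply: sumr_ge0 => j _.
have [lam [x [x0 x_eq x_max]]] := max_rayleigh_quotient eps W_pos.
pose y : 'rV[R]_n.+1 := map_mx Num.norm x.
have y_ge0 i : 0 <= y ord0 i by rewrite mxE.
have WyE : quad_form W y = quad_form W x.
  by rewrite !WE; apply: eq_bigr => i _; rewrite mxE real_normK // num_real.
(* Passing to absolute values keeps the denominator and can only increase
   the numerator, so [y] is a maximizer as well. *)
have y_eq : quad_form eps y = lam * quad_form W y.
  apply/eqP; rewrite eq_le x_max /= WyE -x_eq !quad_formE.
  apply: ler_sum => j _; apply: ler_sum => i _; rewrite !mxE.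
  by apply: le_trans (ler_norm _) _; rewrite !normrM (ger0_norm (eps_ge0 i j)).
have y_ker : y *m (lam *: W - eps) = 0.
  apply: psd_isotropic_kernel.
  - by rewrite linearB linearZ /= tr_diag_mx eps_sym.
  - by move=> z; rewrite quad_formB quad_formZl subr_ge0.
  - by rewrite quad_formB quad_formZl y_eq subrr.
have y_row i : \sum_j eps i j * y ord0 j = lam * (p i)^-1 * y ord0 i.
  have /eqP := y_ker; rewrite mulmxBr subr_eq0 => /eqP/rowP/(_ i).
  rewrite -scalemxAr mul_mx_diag !mxE => yi.
  transitivity (lam * (`|x ord0 i| / p i)); last by ring.
  by rewrite yi; apply: eq_bigr => j _; rewrite -{1}eps_sym !mxE mulrC.
exists lam; exists y^T; last first.
  apply/colP => i; rewrite !mxE.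
  transitivity (p i * \sum_j eps i j * y ord0 j).
    by rewrite mulr_sumr; apply: eq_bigr => j _; rewrite !mxE mulrA.
  by rewrite y_row mxE; field; rewrite gt_eqF.
move=> i; rewrite mxE lt_def y_ge0 andbT; apply/eqP => yi0.
have /rV0Pn [j xj] := x0.
have yj : y ord0 j != 0 by rewrite mxE normr_eq0.
have ij : i != j by apply: contraNneq yj => <-; apply/eqP.
(* The [i]-th row equation now reads [0 = \sum_j eps i j * y j] with
   nonnegative terms, whereas the [j]-th term is positive. *)
have := y_row i; rewrite yi0 mulr0 => /eqP; rewrite psumr_eq0; last first.
  by move=> k _; rewrite mulr_ge0.
move=> /allP /(_ j (mem_index_enum _)) /=.
by rewrite mulf_eq0 (negPf yj) orbF gt_eqF // eps_off.
Qed.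

(** Every eigenvalue [z], with row eigenvector [v], satisfies the entrywise
    inequality [|z| * |v| <= |v| *m A]; multiplying it by the positive vector
    [g] on the right turns it into [|z| * t <= lam * t] with [t = |v| *m g]
    positive. The left eigenvector [u] is there because the spectrum is defined
    through row eigenvectors. *)
Lemma spectral_radius_perron (R : realType) (n : nat) (A : 'M[R]_n)
    (g : 'cV[R]_n) (u : 'rV[R]_n) (lam : R) :
    (forall i j, 0 <= A i j) -> (forall i, 0 < g i ord0) ->
    0 <= lam -> A *m g = lam *: g -> u != 0 -> u *m A = lam *: u ->
  spectral_radius A = lam.
Proof.
move=> A_ge0 g_pos lam_ge0 Ag u0 uA; rewrite /spectral_radius.
set S := [set r : R | _].
have S_lam : S lam.
  exists (real_complex R lam); last by rewrite normc_def /= expr0n addr0 sqrtr_sqr ger0_norm.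
  apply/eigenvalueP; exists (map_mx (real_complex R) u).
    by rewrite -map_mxM uA map_mxZ.
  by rewrite map_mx_eq0.
have S_ub : ubound S lam.
  move=> r [z /eigenvalueP [v vA v0] z_norm].
  pose t : R[i]%C := \sum_j `|v ord0 j| * (g j ord0)%:C%C.
  have t_pos : 0 < t.
    have /rV0Pn [i vi] := v0.
    rewrite /t (bigD1 i) //= ltr_pwDl //.
      by rewrite mulr_gt0 ?normr_gt0 // ltcR.
    by apply: sumr_ge0 => j _; rewrite mulr_ge0 // lecR ltW.
  rewrite -lecR -z_norm -(ler_pM2r t_pos) /t.
  rewrite !mulr_sumr.
  have Ag_row i : \sum_j (A i j)%:C%C * (g j ord0)%:C%C = (lam * g i ord0)%:C%C.
    have /colP/(_ i) := Ag; rewrite !mxE => <-.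
    by rewrite rmorph_sum; apply: eq_bigr => j _; rewrite rmorphM.
  have -> : \sum_i lam%:C%C * (`|v ord0 i| * (g i ord0)%:C%C)
      = \sum_j (\sum_i `|v ord0 i| * (A i j)%:C%C) * (g j ord0)%:C%C.
    under [RHS]eq_bigr do rewrite mulr_suml.
    rewrite exchange_big /=; apply: eq_bigr => i _.
    under eq_bigr do rewrite -mulrA.
    by rewrite -mulr_sumr Ag_row rmorphM /=; ring.
  apply: ler_sum => j _; rewrite mulrA ler_pM2r ?ltcR //.
  have /rowP/(_ j) := vA; rewrite !mxE -normrM => <-.
  apply: le_trans (ler_norm_sum _ _ _) _; apply: ler_sum => i _.
  by rewrite normrM mxE [X in _ * X]ger0_norm // lecR.
apply/eqP; rewrite eq_le ge_sup //=; last by exists lam.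
by rewrite ub_le_sup //; exists lam.
Qed.

(** By symmetry of [eps], the row vector [g i / p i] is a left eigenvector. *)
Lemma weighted_mx_spectral_radius (R : realType) (n : nat)
    (p : 'I_n.+1 -> R) (eps : 'M[R]_n.+1) (g : 'cV[R]_n.+1) (lam : R) :
    eps^T = eps -> (forall i j, 0 <= eps i j) -> (forall i, 0 < p i) ->
    (forall i, 0 < g i ord0) -> weighted_mx p eps *m g = lam *: g ->
  spectral_radius (weighted_mx p eps) = lam.
Proof.
move=> eps_sym eps_ge0 p_pos g_pos Eg.
have Eg_row i : p i * (\sum_j eps i j * g j ord0) = lam * g i ord0.
  have /colP/(_ i) := Eg; rewrite !mxE => <-.
  by rewrite mulr_sumr; apply: eq_bigr => j _; rewrite mxE mulrA.
pose u : 'rV[R]_n.+1 := \row_i (g i ord0 / p i).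
apply: (@spectral_radius_perron _ _ _ g u) => //.
- by move=> i j; rewrite mxE mulr_ge0 // ltW.
- rewrite -(pmulr_lge0 _ (g_pos ord0)) -Eg_row mulr_ge0 ?(ltW (p_pos _)) //.
  by apply: sumr_ge0 => j _; rewrite mulr_ge0 // ltW.
- by apply/rV0Pn; exists ord0; rewrite mxE gt_eqF // divr_gt0.
apply/rowP => j; rewrite !mxE mulrA -Eg_row mulrAC divff ?gt_eqF // mul1r.
apply: eq_bigr => i _; rewrite !mxE -{1}eps_sym mxE.
by field; rewrite gt_eqF.
Qed.

(** * The objective and its minimum over skew-symmetric matrices *)

Lemma objective_row_log_ratio (R : realType) (n : nat) (p : 'I_n -> R)
    (eps : 'M[R]_n) (g : 'cV[R]_n) (i : 'I_n) :
    (forall i, 0 < g i ord0) ->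
  objective_row p eps (log_ratio_mx g) i
    = (weighted_mx p eps *m g) i ord0 / g i ord0.
Proof.
move=> g_pos; rewrite mxE mulr_suml; apply: eq_bigr => j _.
by rewrite !mxE expRD expRN !lnK ?mulrA // posrE.
Qed.

Lemma objective_log_ratio (R : realType) (n : nat) (p : 'I_n.+1 -> R)
    (eps : 'M[R]_n.+1) (g : 'cV[R]_n.+1) (lam : R) :
    (forall i, 0 < g i ord0) -> weighted_mx p eps *m g = lam *: g ->
  objective p eps (log_ratio_mx g) = lam.
Proof.
move=> g_pos Eg.
have row i : objective_row p eps (log_ratio_mx g) i = lam.
  by rewrite objective_row_log_ratio // Eg mxE mulfK // gt_eqF.
rewrite /objective row; under eq_bigr do rewrite row.
by rewrite big_const; elim: #|_| => //= k ->; rewrite maxxx.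
Qed.

Lemma skew_log_ratio_mx (R : realType) (n : nat) (g : 'cV[R]_n) :
  skew_mx (log_ratio_mx g).
Proof. by apply/matrixP => i j; rewrite !mxE opprB. Qed.

(** The maximum over rows dominates any weighted average of the rows; with the
    weights [g i ^+ 2 / p i] the factor [p i] cancels, the coefficients become
    symmetric in [i] and [j], and skew-symmetry of [alpha] makes the arithmetic
    mean - geometric mean inequality applicable to each pair. *)
Lemma objective_skew_lower_bound (R : realType) (n : nat) (p : 'I_n.+1 -> R)
    (eps alpha : 'M[R]_n.+1) (g : 'cV[R]_n.+1) (lam : R) :
    eps^T = eps -> (forall i j, 0 <= eps i j) -> (forall i, 0 < p i) ->
    (forall i, 0 < g i ord0) -> weighted_mx p eps *m g = lam *: g ->
    skew_mx alpha ->
  lam <= objective p eps alpha.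
Proof.
move=> eps_sym eps_ge0 p_pos g_pos Eg alpha_skew.
pose w i := g i ord0 ^+ 2 / p i.
have w_pos i : 0 < w i by rewrite divr_gt0 // exprn_gt0.
have W_pos : 0 < \sum_i w i.
  rewrite (bigD1 ord0) //= ltr_pwDl //.
  by apply: sumr_ge0 => i _; exact: ltW.
rewrite -(ler_pM2r W_pos).
pose T i j := g i ord0 ^+ 2 * eps i j * expR (alpha i j).
apply: (@le_trans _ _ (\sum_i \sum_j T i j)); last first.
  rewrite mulr_sumr; apply: ler_sum => i _.
  have -> : \sum_j T i j = objective_row p eps alpha i * w i.
    rewrite mulr_suml; apply: eq_bigr => j _; rewrite /T /w.
    by field; rewrite gt_eqF.
  rewrite ler_pM2r //; exact: le_bigmax.
have -> : lam * \sum_i w i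
    = \sum_i \sum_j g i ord0 * eps i j * g j ord0.
  rewrite mulr_sumr; apply: eq_bigr => i _.
  transitivity (g i ord0 / p i * (lam *: g) i ord0).
    by rewrite mxE /w; ring.
  rewrite -Eg mxE mulr_sumr; apply: eq_bigr => j _; rewrite mxE.
  by field; rewrite gt_eqF.
(* Doubling the right-hand side and transposing one copy pairs the term
   [(i, j)] with the term [(j, i)]. *)
rewrite -(ler_pM2l (ltr0n R 2)) [leRHS]mulr_natl mulr2n.
rewrite [X in _ <= X + _]exchange_big /= -big_split mulr_sumr; apply: ler_sum => i _ /=.
rewrite -big_split mulr_sumr; apply: ler_sum => j _ /=; rewrite /T.
have -> : eps j i = eps i j by rewrite -{1}eps_sym mxE.
have -> : alpha j i = - alpha i j.
  by have /matrixP/(_ j i) := alpha_skew; rewrite !mxE.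
rewrite expRN -subr_ge0.
have := expR_gt0 (alpha i j); set e := expR _ => e_pos.
(* The gap in the mean inequality is a perfect square divided by [e]. *)
rewrite (_ : _ - _ = eps i j * (g i ord0 * e - g j ord0) ^+ 2 / e); last first.
  by field; rewrite gt_eqF.
by rewrite divr_ge0 ?(ltW e_pos) // mulr_ge0 ?sqr_ge0.
Qed.

Theorem proposition3p3 (R : realType) (n : nat)
    (eps : 'M[R]_n.+1) (p : 'I_n.+1 -> R)
    (eps_sym : eps^T = eps)
    (eps_diag : forall i, eps i i = 0)
    (eps_pos : forall i j, i != j -> 0 < eps i j)
    (p_pos : forall i, 0 < p i) :
  let E := weighted_mx p eps in
  let rho := spectral_radius E in
  let f := objective p eps in
  exists2 eps_star : R,
    is_minimum (f @` @skew_mx R n.+1) eps_star &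
    (exists2 g : 'cV[R]_n.+1,
       forall i, 0 < g i ord0 & E *m g = rho *: g) /\
    (forall g : 'cV[R]_n.+1,
       (forall i, 0 < g i ord0) -> E *m g = rho *: g ->
       [/\ skew_mx (log_ratio_mx g),
           eps_star = f (log_ratio_mx g) &
           f (log_ratio_mx g) = rho]).
Proof.
move=> E rho f.
have eps_diag_ge0 i : 0 <= eps i i by rewrite eps_diag.
have eps_ge0 i j : 0 <= eps i j.
  by have [->|/eps_pos/ltW] := eqVneq i j.
have [lam [g g_pos Eg]] :=
  weighted_mx_perron_vector eps_sym eps_diag_ge0 eps_pos p_pos.
have rhoE : rho = lam by exact: (weighted_mx_spectral_radius eps_sym _ _ g_pos).
exists rho; last split.
- split.
    exists (log_ratio_mx g); first exact: skew_log_ratio_mx.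
    by rewrite rhoE; exact: objective_log_ratio.
  move=> _ [alpha alpha_skew <-]; rewrite rhoE.
  exact: (objective_skew_lower_bound eps_sym _ _ g_pos).
- by exists g => //; rewrite rhoE.
move=> h h_pos Eh; split; first exact: skew_log_ratio_mx.
- by rewrite /f (objective_log_ratio h_pos Eh).
- exact: objective_log_ratio.
Qed.
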